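(* Let $G=(V,E)$ be a finite directed graph with vertex set $V=\{v_1,\dots,v_N\}$ in which every vertex has an incoming edge and an outgoing edge, with $|E|\ge 2$. Let $A_G(i,j)$ be the number of edges from $v_i$ to $v_j$. Define the formal power series $f^G(x)=\sum_{n\ge0}c_n^Gx^n$ and $f_i^G(x)=\sum_{n\ge0}c_n^G(i)x^n$ for $i=1,\dots,N$. Then: (i) $f^G(x)=\sum_{i=1}^N f_i^G(x)$; (ii) for $i=1,\dots,N$, $$f_i^G(x)=1+x f_i^G(x)\sum_{j=1}^N A_G(j,i)f_j^G(x).$$
   Context: For $e\in E$ let $s(e),t(e)$ be its source and terminal vertex; loops and multiple edges are allowed. Let $A^G(e,f)=1$ if $t(e)=s(f)$ and $0$ otherwise ($e,f\in E$). $\mathcal{O}_{A^G}$ is the Cuntz-Krieger algebra: the universal $C^*$-algebra generated by partial isometries $S_e$, $e\in E$, with $\sum_{f\in E}S_fS_f^*=1$ and $S_e^*S_e=\sum_{f\in E}A^G(e,f)S_fS_f^*$. For $v\in V$ put $P_v=\sum_{f\in E,\,s(f)=v}S_fS_f^*$. Let $\Sigma_G=\{S_e^*,S_e\mid e\in E\}$ (a set of $2|E|$ symbols). For a word $X=(X_1,\dots,X_{2n})$ in $\Sigma_G$ put $\pi_G(X)=X_1\cdots X_{2n}\in\mathcal{O}_{A^G}$. Let $\Phi_G$ replace each $S_e$ (resp. $S_e^*$) by the canonical isometry indexed by $e$ (resp. its adjoint) in the Cuntz algebra $\mathcal{O}_{|E|}$ generated by isometries $\{\hat S_e\}_{e\in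 E}$ with $\hat S_e^*\hat S_e=1$, $\sum_e\hat S_e\hat S_e^*=1$. For $n\ge1$, $B_n^G$ is the set of words $X$ of length $2n$ in $\Sigma_G$ with $\pi_G(X)\neq0$ in $\mathcal{O}_{A^G}$ and $\Phi_G(X_1)\cdots\Phi_G(X_{2n})=1$ in $\mathcal{O}_{|E|}$. For each $X\in B_n^G$ there is a unique vertex $v(X)$ with $\pi_G(X)=P_{v(X)}$. Put $c_0^G=N$, $c_0^G(i)=1$ and, for $n\ge1$, $c_n^G=|B_n^G|$, $c_n^G(i)=|\{X\in B_n^G\mid v(X)=v_i\}|$. *)

(* Defs.v *)
From HB Require Import structures.
From mathcomp Require Import all_boot all_order all_algebra.
From mathcomp Require Import all_classical all_reals all_analysis.
From mathcomp Require Import complex.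
Import Order.TTheory GRing.Theory Num.Theory.
Import numFieldNormedType.Exports.

Set Implicit Arguments.
Unset Strict Implicit.
Unset Printing Implicit Defensive.

Local Open Scope ring_scope.

(* Unital C*-algebras over the complex numbers R[i]. The norm is a separate
   real-valued operation because the library's hierarchy forces a type that is
   both a ring and a normed module to be a numDomainType. *)
HB.mixin Record isCStarAlgebra (R : realType) A & GRing.Algebra R[i] A := {
  star : A -> A;
  cnorm : A -> R;
  starK : involutive star;
  starD : {morph star : x y / x + y};
  starZ : forall (a : R[i]) (x : A), star (a *: x) = a^* *: star x;
  starM : forall x y : A, star (x * y) = star y * star x;
  cnorm0_eq0 : forall x : A, cnorm x = 0 -> x = 0;
  cnormD : forall x y : A, cnorm (x + y) <= cnorm x + cnorm y;
  cnormZ : forall (a : R[i]) (x : A),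
    cnorm (a *: x) = ComplexField.Normc.normc a * cnorm x;
  cnormM : forall x y : A, cnorm (x * y) <= cnorm x * cnorm y;
  cstar_identity : forall x : A, cnorm (star x * x) = cnorm x ^+ 2;
  cstar_complete : forall u : nat -> A,
    (forall eps : R, 0 < eps -> exists n0 : nat, forall m n : nat,
       (n0 <= m)%N -> (n0 <= n)%N -> cnorm (u m - u n) < eps) ->
    exists l : A, (cnorm (u n - l) @[n --> \oo] --> (0 : R))%classic
}.

#[short(type="cstarAlgType")]
HB.structure Definition CStarAlgebra (R : realType) :=
  {A of GRing.Algebra R[i] A & isCStarAlgebra R A}.

Section UniversalAlgebras.
Variables (R : realType) (E : finType).

Definition star_hom (A B : cstarAlgType R) (phi : A -> B) : Prop :=
  [/\ (forall (a : R[i]) x y, phi (a *: x + y) = a *: phi x + phi y),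
      phi 1 = 1,
      {morph phi : x y / x * y} &
      {morph phi : x / star x}].

(* (A, a) is the universal C*-algebra generated by an E-indexed family subject
   to the relations rel. Uniqueness of phi expresses that a generates A. *)
Definition universal_for (rel : forall B : cstarAlgType R, (E -> B) -> Prop)
    (A : cstarAlgType R) (a : E -> A) : Prop :=
  rel A a /\
  forall (B : cstarAlgType R) (b : E -> B), rel B b ->
    exists! phi : A -> B, star_hom phi /\ forall e, phi (a e) = b e.

Definition cuntz_krieger_family (M : rel E)
    (B : cstarAlgType R) (S : E -> B) : Prop :=
  [/\ (forall e, S e * star (S e) * S e = S e),
      \sum_f S f * star (S f) = 1 &
      forall e, star (S e) * S e = \sum_f (S f * star (S f)) *+ M e f].

Definition cuntz_family (B : cstarAlgType R) (S : E -> B) : Prop :=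
  (forall e, star (S e) * S e = 1) /\ \sum_e S e * star (S e) = 1.

Definition is_cuntz_krieger_algebra (M : rel E)
    (A : cstarAlgType R) (S : E -> A) : Prop :=
  universal_for (cuntz_krieger_family M) S.

Definition is_cuntz_algebra (A : cstarAlgType R) (S : E -> A) : Prop :=
  universal_for cuntz_family S.

End UniversalAlgebras.

(* The symbols of Sigma_G: inl e stands for S_e and inr e for S_e^*. *)
Notation symbol E := (E + E)%type.

Section Words.
Variables (R : realType) (E : finType).

Definition eval_symbol (A : cstarAlgType R) (S : E -> A) (x : symbol E) : A :=
  match x with inl e => S e | inr e => star (S e) end.

Definition eval_word (A : cstarAlgType R) (S : E -> A) (X : seq (symbol E)) : A :=
  \prod_(x <- X) eval_symbol S x.

End Words.

Section GraphCatalan.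
Variables (R : realType) (N : nat) (E : finType) (s t : E -> 'I_N).

Definition edge_matrix : rel E := fun e f => t e == s f.

Definition vertex_matrix (i j : 'I_N) : nat :=
  #|[set e : E | (s e == i) && (t e == j)]|.

Variables (OA : cstarAlgType R) (S : E -> OA).
Variables (OE : cstarAlgType R) (Shat : E -> OE).

Definition vertex_proj (v : 'I_N) : OA :=
  \sum_(f | s f == v) S f * star (S f).

Definition catalan_words (n : nat) : {set (2 * n).-tuple (symbol E)} :=
  [set X : (2 * n).-tuple (symbol E) |
    (eval_word S X != 0) && (eval_word Shat X == 1)].

Definition catalan_number (n : nat) : nat :=
  if n is 0 then N else #|catalan_words n|.

Definition catalan_number_at (i : 'I_N) (n : nat) : nat :=
  if n is 0 then 1%N
  else #|[set X : (2 * n).-tuple (symbol E) in catalan_words n |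
          eval_word S X == vertex_proj i]|.

End GraphCatalan.

Record fps (R : Type) := Fps { fps_coef : nat -> R }.

HB.instance Definition _ (R : Type) := [isNew for @fps_coef R].
HB.instance Definition _ (R : choiceType) := [Choice of fps R by <:].

Section FormalPowerSeries.
Variable R : comNzRingType.
Implicit Types f g h : fps R.

Lemma fpsP f g : fps_coef f =1 fps_coef g -> f = g.
Proof. by case: f g => [f] [g] /= /funext ->. Qed.

Definition fps_zero : fps R := Fps (fun=> 0).
Definition fps_opp f : fps R := Fps (fun n => - fps_coef f n).
Definition fps_add f g : fps R := Fps (fun n => fps_coef f n + fps_coef g n).
Definition fps_one : fps R := Fps (fun n => (n == 0%N)%:R).
Definition fps_mul f g : fps R :=
  Fps (fun n => \sum_(k < n.+1) fps_coef f k * fps_coef g (n - k)).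
Definition fpsX : fps R := Fps (fun n => (n == 1%N)%:R).

Let fps_addA : associative fps_add.
Proof. by move=> f g h; apply: fpsP => n /=; rewrite addrA. Qed.
Let fps_addC : commutative fps_add.
Proof. by move=> f g; apply: fpsP => n /=; rewrite addrC. Qed.
Let fps_add0 : left_id fps_zero fps_add.
Proof. by move=> f; apply: fpsP => n /=; rewrite add0r. Qed.
Let fps_addN : left_inverse fps_zero fps_opp fps_add.
Proof. by move=> f; apply: fpsP => n /=; rewrite addNr. Qed.

HB.instance Definition _ :=
  GRing.isZmodule.Build (fps R) fps_addA fps_addC fps_add0 fps_addN.

Let trunc m f : {poly R} := \poly_(i < m) fps_coef f i.

Let coef_mul_trunc f g n m : (n < m)%N ->
  fps_coef (fps_mul f g) n = (trunc m f * trunc m g)`_n.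
Proof.
move=> nm; rewrite coefM /=; apply: eq_bigr => k _.
by rewrite !coef_poly !(leq_ltn_trans _ nm) ?leq_subr // -ltnS.
Qed.

Let fps_mulC : commutative fps_mul.
Proof.
by move=> f g; apply: fpsP => n; rewrite !(coef_mul_trunc _ _ (ltnSn n)) mulrC.
Qed.

Let fps_mulA : associative fps_mul.
Proof.
move=> f g h; apply: fpsP => n.
have mulE (p q : {poly R}) : (forall k, (k <= n)%N -> p`_k = q`_k) ->
    forall r, (p * r)`_n = (q * r)`_n.
  by move=> pq r; rewrite !coefM; apply: eq_bigr => k _; rewrite pq // -ltnS.
have truncM f1 g1 k : (k <= n)%N ->
    (trunc n.+1 (fps_mul f1 g1))`_k = (trunc n.+1 f1 * trunc n.+1 g1)`_k.
  by move=> kn; rewrite coef_poly ltnS kn -coef_mul_trunc.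
rewrite !(coef_mul_trunc _ _ (ltnSn n)) mulrC (mulE _ _ (truncM g h)).
by rewrite (mulE _ _ (truncM f g)) mulrC mulrA.
Qed.

Let fps_mul1 : left_id fps_one fps_mul.
Proof.
move=> f; apply: fpsP => n /=; rewrite big_ord_recl /= mul1r subn0 big1 ?addr0//.
by move=> k _; rewrite mul0r.
Qed.

Let fps_mulDl : left_distributive fps_mul fps_add.
Proof.
move=> f g h; apply: fpsP => n /=; rewrite -big_split /=.
by apply: eq_bigr => k _; rewrite mulrDl.
Qed.

Let fps_one_neq0 : fps_one != 0 :> fps R.
Proof.
by apply/eqP => /(congr1 (fun f => fps_coef f 0))/eqP; rewrite /= oner_eq0.
Qed.

HB.instance Definition _ := GRing.Zmodule_isComNzRing.Build (fps R)
  fps_mulA fps_mulC fps_mul1 fps_mulDl fps_one_neq0.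

End FormalPowerSeries.

Definition gen_series (c : nat -> nat) : fps int := Fps (fun n => Posz (c n)).

(* Main.v *)
From HB Require Import structures.
Require Import Defs.
From mathcomp Require Import all_boot all_order all_algebra.
From mathcomp Require Import all_classical all_reals all_analysis.
From mathcomp Require Import complex lra zify.
Import Order.TTheory GRing.Theory Num.Theory.
Import numFieldNormedType.Exports.

(* Read a word from left to right, pushing [e] on a stack at [S_e^*] and popping
   it at [S_e]. In a Cuntz algebra on at least two generators the word evaluates
   to 1 iff it is a Dyck word for this stack discipline. In the Cuntz-Krieger
   algebra [P_i] times a Dyck word is [P_i] if each pushed edge ends where the
   edge below it starts (at [i] for the bottom one), and 0 otherwise. Splitting
   a nonempty word as [S_e^* Y S_e Z] gives the functional equation.
   Two analytic points are needed. The ranges of the [S_e] are pairwise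
   orthogonal: projections with sum 1 are, since the unit of a corner is an
   extreme point of its unit ball. The [P_v] are nonzero: a corner of the given
   Cuntz algebra contains a unital copy of O_2, hence Cuntz families of every
   finite size, and these assemble into a Cuntz-Krieger family for the graph
   with all vertex projections nonzero, onto which the universal one maps. *)

Set Implicit Arguments.
Unset Strict Implicit.
Unset Printing Implicit Defensive.

Local Open Scope ring_scope.

(** * Norm estimates and extremality of idempotents *)

Section Norm.
Variables (R : realType) (A : cstarAlgType R).
Implicit Types x y p : A.

Lemma star0 : star (0 : A) = 0.
Proof. by apply: (addrI (star (0 : A))); rewrite -starD !addr0. Qed.

Lemma starN x : star (- x) = - star x.
Proof. by apply: (addrI (star x)); rewrite -starD !subrr star0. Qed.

Lemma starB x y : star (x - y) = star x - star y.
Proof. by rewrite starD starN. Qed.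

Lemma star1 : star (1 : A) = 1.
Proof. by rewrite -[LHS]mulr1 -{2}[1 : A]starK -starM mulr1 starK. Qed.

Lemma star_sum (I : Type) (r : seq I) (P : pred I) (F : I -> A) :
  star (\sum_(i <- r | P i) F i) = \sum_(i <- r | P i) star (F i).
Proof. exact: (big_morph _ (@starD R A) star0). Qed.

Lemma cnorm0 : cnorm (0 : A) = 0.
Proof.
by rewrite -(scale0r (0 : A)) cnormZ ComplexField.Normc.normc0 mul0r.
Qed.

Lemma cnormN x : cnorm (- x) = cnorm x.
Proof.
by rewrite -scaleN1r cnormZ normcN ComplexField.Normc.normc1 mul1r.
Qed.

Lemma cnorm_ge0 x : 0 <= cnorm x.
Proof. by have := cnormD x (- x); rewrite subrr cnorm0 cnormN; lra. Qed.

Lemma cnorm_natmul x n : cnorm (x *+ n) = cnorm x *+ n.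
Proof.
by rewrite -scaler_nat cnormZ normcMn ComplexField.Normc.normc1 mulr_natl.
Qed.

Lemma cnorm_sum (I : Type) (r : seq I) (P : pred I) (F : I -> A) :
  cnorm (\sum_(i <- r | P i) F i) <= \sum_(i <- r | P i) cnorm (F i).
Proof.
elim/big_rec2: _ => [|i y x _ le_xy]; first by rewrite cnorm0.
by rewrite (le_trans (cnormD _ _))// lerD2l.
Qed.

(** The C*-identity gives [cnorm p = cnorm p ^+ 2]. *)
Lemma selfadjoint_idem_cnorm_le1 p : star p = p -> p * p = p -> cnorm p <= 1.
Proof.
move=> ps pp; have := cstar_identity p; rewrite ps pp => e.
have := cnorm_ge0 p; nra.
Qed.

Lemma cnormX_le1 x n : cnorm x <= 1 -> cnorm (x ^+ n) <= 1.
Proof.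
move=> x1; elim: n => [|n IH].
  by rewrite selfadjoint_idem_cnorm_le1 ?star1 ?mulr1.
by rewrite exprS (le_trans (cnormM _ _))// mulr_ile1 ?cnorm_ge0.
Qed.

Lemma star_mul_eq0 x : star x * x = 0 -> x = 0.
Proof.
move=> x0; apply: cnorm0_eq0; apply/eqP; rewrite -sqrf_eq0.
by rewrite -cstar_identity x0 cnorm0.
Qed.

End Norm.

(** * Central binomial coefficients *)

Lemma leq_bin_half n j : (j.*2 < n)%N -> ('C(n, j) <= 'C(n, j.+1))%N.
Proof.
move=> jn; rewrite -(leq_pmul2l (ltn0Sn j)) mul_bin_left leq_mul2r.
by apply/orP; right; lia.
Qed.

Lemma central_bin_rec m :
  (m.+2 * 'C(m.+1.*2.+1, m.+1) = 2 * m.*2.+3 * 'C(m.*2.+1, m))%N.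
Proof.
rewrite doubleS binS mulnDr.
have := mul_bin_left m.*2.+2 m; rewrite (_ : m.*2.+2 - m = m.+2)%N; last by lia.
move=> <-; rewrite binS.
have -> : 'C(m.*2.+1, m.+1) = 'C(m.*2.+1, m).
  by rewrite -[in LHS]bin_sub; [congr binomial|]; lia.
by lia.
Qed.

(** The estimate of order [4 ^ m / sqrt m] for the central coefficient, squared to stay in the
    integers. By [central_bin_rec] the induction step reduces to (2m+3)(2m+5) <= (2m+4)^2. *)
Lemma central_bin_sqr_le m : ('C(m.*2.+1, m) ^ 2 * m.*2.+3 <= 4 * 16 ^ m)%N.
Proof.
elim: m => [//|m IH]; rewrite -(@leq_pmul2l (m.+2 ^ 2)%N) ?expn_gt0//.
rewrite mulnA -expnMn central_bin_rec (expnS 16) doubleS.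
move: ('C(_, _)) (16 ^ m)%N IH => b P IH.
apply: (@leq_trans (4 * m.*2.+3 * m.*2.+1.+4 * (b ^ 2 * m.*2.+3))%N).
  by nia.
apply: (@leq_trans (4 * m.*2.+3 * m.*2.+1.+4 * (4 * P))%N).
  by rewrite leq_mul2l IH orbT.
rewrite (_ : 4 * _ * _ * _ = (m.*2.+3 * m.*2.+1.+4) * (16 * P))%N; last by nia.
rewrite (_ : m.+2 ^ 2 * _ = (4 * m.+2 ^ 2) * (16 * P))%N; last by nia.
by rewrite leq_mul2r; apply/orP; right; nia.
Qed.

Section Extreme.
Variables (R : realType) (A : cstarAlgType R).
Implicit Types x y p u v : A.

(* Summation by parts: the weights increase, so the total variation of the
   coefficients of the [W j] is at most [c k] plus the boundary terms. *)
Lemma cnorm_sum_by_parts (W : nat -> A) (c : nat -> nat) (k : nat) :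
  (forall j, cnorm (W j) <= 1) ->
  (forall j, (j < k)%N -> (c j <= c j.+1)%N) ->
  cnorm (\sum_(j < k.+1) (W j.+1 - W j) *+ c j) <= 2 * (c k)%:R.
Proof.
move=> W1 cS; pose Z m := \sum_(j < m.+1) (W j.+1 - W j) *+ c j - W m.+1 *+ c m.
have Wc j n : cnorm (W j *+ n) <= n%:R.
  by rewrite cnorm_natmul -[n%:R]mulr1 mulr_natl lerMn2r W1 orbT.
have ZP m : (m <= k)%N -> cnorm (Z m) <= (c m)%:R.
  elim: m => [_|m IH mk].
    rewrite /Z big_ord_recl big_ord0 addr0 mulrnBl addrC addKr cnormN.
    exact: Wc.
  have -> : Z m.+1 = Z m - W m.+1 *+ (c m.+1 - c m).
    rewrite /Z big_ord_recr/= mulrnBr ?cS// mulrnBl -!addrA; congr (_ + _).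
    by rewrite opprB addKr addrA addrAC subrr add0r.
  rewrite (le_trans (cnormD _ _))// cnormN.
  rewrite (le_trans (lerD (IH (ltnW mk)) (Wc _ _)))//.
  by rewrite -natrD subnKC ?cS.
rewrite -(subrK (W k.+1 *+ c k) (\sum_(_ < _) _)) (le_trans (cnormD _ _))//.
by rewrite mulrDl mul1r lerD ?ZP.
Qed.

(** The product telescopes into differences of the [W j] weighted by the coefficients ['C(n, j)]. As
    [n] is odd, these split into two symmetric halves of [m.+1] terms, monotone on each, and
    summation by parts bounds each half by twice the central coefficient. *)
Lemma cnorm_binomial_bound u v m : GRing.comm u v ->
  cnorm u <= 1 -> cnorm v <= 1 ->
  cnorm ((v - u) * (u + v) ^+ m.*2.+1) <= 4 * ('C(m.*2.+1, m))%:R.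
Proof.
move=> uv u1 v1; set n := m.*2.+1.
pose W j := u ^+ (n.+1 - j) * v ^+ j.
have W1 j : cnorm (W j) <= 1.
  by rewrite (le_trans (cnormM _ _))// mulr_ile1 ?cnorm_ge0 ?cnormX_le1.
have -> : (v - u) * (u + v) ^+ n =
    \sum_(j < m.+1 + m.+1) (W j.+1 - W j) *+ 'C(n, j).
  have -> : (m.+1 + m.+1 = n.+1)%N by rewrite /n; lia.
  rewrite exprDn_comm// mulr_sumr; apply: eq_bigr => j _.
  have jn : (j <= n)%N by rewrite -ltnS.
  rewrite mulrnAr; congr (_ *+ _); rewrite mulrBl /W subSS subSn//.
  congr (_ - _); last by rewrite exprS mulrA.
  by rewrite mulrA (commrX _ (commr_sym uv)) -mulrA -exprS.
rewrite big_split_ord/= (le_trans (cnormD _ _))//.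
rewrite (_ : 4 = 2 + 2 :> R); last by lra.
rewrite mulrDl lerD//.
  by apply: (@cnorm_sum_by_parts W (fun j => 'C(n, j))) => // j jm;
    rewrite leq_bin_half// /n; lia.
(* Reversing the upper half makes its weights increase; the sign restores the orientation of the
   differences. *)
rewrite (reindex_inj rev_ord_inj)/= -cnormN -sumrN.
rewrite [X in cnorm X](_ : _ = \sum_(j < m.+1)
    (W (n.+1 - j.+1)%N - W (n.+1 - j)%N) *+ 'C(n, j)); last first.
  apply: eq_bigr => j _; have jm := ltn_ord j.
  rewrite -mulNrn opprB; congr ((W _ - W _) *+ _); rewrite ?/n; try lia.
  by rewrite -[in RHS]bin_sub; [congr binomial|]; rewrite /n; lia.
apply: (@cnorm_sum_by_parts (fun j => W (n.+1 - j)%N) (fun j => 'C(n, j))) => //.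
by move=> j jm; rewrite leq_bin_half// /n; lia.
Qed.

(* A form of the fact that the unit of a Banach algebra (here of the corner
   [p A p]) is an extreme point of the unit ball. Expanding
   [2 ^ n * x] as [((p + x) - (p - x)) * ((p + x) + (p - x)) ^ n / 2] bounds [x]
   by the total variation of the binomial distribution, of order [1 / sqrt n]. *)
Lemma idem_extreme p x : p * p = p -> p * x = x -> x * p = x ->
  cnorm (p + x) <= 1 -> cnorm (p - x) <= 1 -> x = 0.
Proof.
move=> pp px xp h1 h2.
have comm : GRing.comm (p - x) (p + x).
  by rewrite /GRing.comm mulrBl mulrBr !mulrDr !mulrDl pp px xp.
have pow n : (p + x - (p - x)) * (p - x + (p + x)) ^+ n = x *+ 2 ^ n.+1.
  have -> : p + x - (p - x) = x *+ 2.
    by rewrite opprD opprK addrACA subrr add0r mulr2n.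
  have -> : p - x + (p + x) = p *+ 2 by rewrite addrACA addNr addr0 mulr2n.
  elim: n => [|n IH]; first by rewrite expr0 mulr1.
  by rewrite exprSr mulrA IH mulrnAr mulrnAl xp -mulrnA -expnSr.
(* Squaring avoids the square root. The bound holds for every [m], so the Archimedean property
   leaves only [x = 0]. *)
have bnd m : cnorm x ^+ 2 * (m.*2.+3)%:R <= 4.
  have := cnorm_binomial_bound m comm h2 h1.
  rewrite pow cnorm_natmul => le1.
  have := central_bin_sqr_le m; rewrite -(ler_nat R) natrM natrM !natrX => le2.
  have : (cnorm x * (2 ^ m.*2.+2)%:R) ^+ 2 <= (4 * 'C(m.*2.+1, m)%:R) ^+ 2.
    by rewrite ler_sqr ?nnegrE ?mulr_ge0 ?cnorm_ge0 ?ler0n // [cnorm x * _]mulr_natr.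
  rewrite !exprMn.
  have -> : (2 ^ m.*2.+2)%:R ^+ 2 = 16 * 16 ^+ m :> R.
    have -> : 16 = 2 ^+ 4 :> R by rewrite -natrX.
    by rewrite -exprM -exprD natrX -exprM; congr (_ ^+ _); lia.
  have : 0 < 16 ^+ m :> R by rewrite exprn_gt0.
  move: (16 ^+ m) (cnorm x ^+ 2) ('C(_, m)%:R ^+ 2) le2 => P X b le2 P0 leX.
  rewrite -(ler_pM2l P0); have := ler_wpM2r (ler0n R m.*2.+3) leX.
  by move: (_%:R) le2 => M; lra.
apply: cnorm0_eq0; apply/eqP; rewrite -sqrf_eq0; apply/negPn/negP => xn0.
have xp0 : 0 < cnorm x ^+ 2 by rewrite lt_def xn0 exprn_ge0 ?cnorm_ge0.
have := archi_boundP (divr_ge0 (ler0n R 4) (ltW xp0)).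
rewrite ltr_pdivrMr// => lt4; have := bnd (Num.bound (4 / cnorm x ^+ 2)).
apply/negP; rewrite -ltNge mulrC (lt_le_trans lt4)//.
rewrite (ler_wpM2r (ltW xp0))// ler_nat.
by rewrite -addnn; do 3 apply: leqW; rewrite leq_addr.
Qed.

End Extreme.

(** * Orthogonality of projections with sum 1 *)

Section Orthogonality.
Variables (R : realType) (A : cstarAlgType R) (I : finType).

(* Compressing [\sum_f p f = 1] to the corner of [p j] gives
   [\sum_(f != j) p j * p f * p j = 0], a vanishing sum of elements [a f] with
   [cnorm (p j - a f) <= 1]; extremality of [p j] then forces [a i = 0]. *)
Lemma proj_sum1_orth (p : I -> A) :
  (forall i, star (p i) = p i) -> (forall i, p i * p i = p i) ->
  \sum_i p i = 1 -> forall i j, i != j -> p i * p j = 0.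
Proof.
move=> ps pp sum1 i j ij; apply: star_mul_eq0.
rewrite starM !ps mulrA -(mulrA (p j)) pp.
pose a f := p j * p f * p j; rewrite -/(a i).
pose m := #|[pred f | f != j]|.
have m0 : (0 < m)%N by apply/card_gt0P; exists i.
have suma : \sum_(f | f != j) a f = 0.
  have : \sum_f a f = p j by rewrite -mulr_suml -mulr_sumr sum1 mulr1 pp.
  by rewrite (bigD1 j)//= {1}/a !pp -[RHS]addr0 => /addrI.
have p1 f : cnorm (p f) <= 1 by exact: selfadjoint_idem_cnorm_le1.
have pa1 f : cnorm (p j - a f) <= 1.
  have -> : p j - a f = p j * (1 - p f) * p j by rewrite mulrBr mulrBl mulr1 pp.
  rewrite (le_trans (cnormM _ _))// mulr_ile1 ?cnorm_ge0//.
  rewrite (le_trans (cnormM _ _))// mulr_ile1 ?cnorm_ge0//.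
  apply: selfadjoint_idem_cnorm_le1; first by rewrite starB star1 ps.
  by rewrite mulrBr mulr1 mulrBl mul1r pp subrr subr0.
(* With this scaling both [p j + x] and [p j - x] are averages of [m] elements of the unit ball: for
   [+], replace [a i] by minus the sum of the other [a f]; for [-], take [p j - a i] once and [p j]
   otherwise. *)
pose x := (m%:R : R[i])^-1 *: a i.
have xm : x *+ m = a i.
  by rewrite -scaler_nat scalerA mulfV ?scale1r// pnatr_eq0 -lt0n.
have bnd (y : A) (g : I -> A) : y *+ m = \sum_(f | f != j) g f ->
    (forall f, cnorm (g f) <= 1) -> cnorm y <= 1.
  move=> ym g1; rewrite -(ler_pMn2r m0) -cnorm_natmul ym.
  rewrite (le_trans (cnorm_sum _ _ _))// -sumr_const; exact: ler_sum.
suff x0 : x = 0 by rewrite -xm x0 mul0rn.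
have sumg (y z : A) : \sum_(f | f != j) (if f == i then y else z) = z *+ m.-1 + y.
  rewrite (bigD1 i)//= eqxx addrC; congr (_ + _).
  rewrite (eq_bigr (fun=> z)) => [|f /andP[_ /negbTE->]//].
  rewrite sumr_const; congr (_ *+ _).
  rewrite /m [in RHS](cardD1 i) inE ij add1n/=.
  by apply: eq_card => f; rewrite !inE andbC.
apply: (idem_extreme (pp j)).
- by rewrite /x /a -scalerAr !mulrA pp.
- by rewrite /x /a -scalerAl -!mulrA pp.
- apply: (bnd _ (fun f => p j - (if f == i then 0 else a f))).
    rewrite mulrnDl xm sumrB sumr_const; congr (_ + _).
    rewrite (bigD1 i)//= eqxx add0r.
    rewrite (eq_bigr a) => [|f /andP[_ /negbTE->]//].
    by move: suma; rewrite (bigD1 i)//= => /eqP; rewrite addr_eq0 => /eqP.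
  by move=> f; case: ifP => _; rewrite ?subr0.
- apply: (bnd _ (fun f => if f == i then p j - a i else p j)).
    rewrite mulrnBl xm sumg addrA; congr (_ - _).
    by rewrite -mulrSr prednK.
  by move=> f; case: ifP.
Qed.

(** The range projections are orthogonal by [proj_sum1_orth], and [star (S e) * S f] contains their
    product once [S e] and [S f] are multiplied by their range projections. *)
Lemma partial_isometries_orth (S : I -> A) :
  (forall e, S e * star (S e) * S e = S e) -> \sum_f S f * star (S f) = 1 ->
  forall e f, e != f -> star (S e) * S f = 0.
Proof.
move=> SSS sum1 e f ef; rewrite -(SSS f) -(SSS e) !starM starK.
have := @proj_sum1_orth (fun e => S e * star (S e)) _ _ sum1 _ _ ef => /= o.
rewrite -!mulrA (mulrA (S e)) (mulrA (S f)) (mulrA (S e * _)) o ?mul0r ?mulr0//.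
  by move=> i; rewrite starM starK.
by move=> i; rewrite mulrA SSS.
Qed.

End Orthogonality.

(** * Corners of a C*-algebra *)

(** Bundling the proofs with the projection lets the corner be a type on which the algebra
    structures are declared. Nonvanishing gives [1 != 0] in the corner, whose unit is the
    projection. *)
Record nonzero_proj (R : realType) (A : cstarAlgType R) := NonzeroProj {
  proj_val : A;
  proj_star : star proj_val = proj_val;
  proj_idem : proj_val * proj_val = proj_val;
  proj_neq0 : proj_val != 0 }.

Section Corner.
Variables (R : realType) (A : cstarAlgType R) (Q : nonzero_proj A).
Local Notation q := (proj_val Q).

Record corner := Corner {
  corner_val : A;
  corner_valP : q * corner_val * q == corner_val }.

HB.instance Definition _ := [isSub for corner_val].
HB.instance Definition _ := [Choice of corner by <:].

Implicit Types x y z : corner.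

Lemma corner_mull x : q * val x = val x.
Proof. by rewrite -(eqP (valP x)) !mulrA proj_idem. Qed.

Lemma corner_mulr x : val x * q = val x.
Proof. by rewrite -(eqP (valP x)) -!mulrA proj_idem. Qed.

Let zeroP : q * 0 * q == 0. Proof. by rewrite mulr0 mul0r. Qed.
Let oneP : q * q * q == q. Proof. by rewrite !proj_idem. Qed.
Let addP x y : q * (val x + val y) * q == val x + val y.
Proof. by rewrite mulrDr mulrDl !corner_mull !corner_mulr. Qed.
Let oppP x : q * - val x * q == - val x.
Proof. by rewrite mulrN mulNr corner_mull corner_mulr. Qed.
Let mulP x y : q * (val x * val y) * q == val x * val y.
Proof. by rewrite mulrA corner_mull -mulrA corner_mulr. Qed.
Let scaleP (c : R[i]) x : q * (c *: val x) * q == c *: val x.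
Proof. by rewrite -scalerAr -scalerAl corner_mull corner_mulr. Qed.
Let starP x : q * star (val x) * q == star (val x).
Proof.
have sq (y : A) : q * star y * q = star (q * y * q).
  by rewrite !starM proj_star mulrA.
by rewrite sq (eqP (valP x)).
Qed.

Let cadd x y := Corner (addP x y).
Let copp x := Corner (oppP x).
Let cmul x y := Corner (mulP x y).
Let cscale c x := Corner (scaleP c x).

Let caddA : associative cadd.
Proof. by move=> x y z; apply: val_inj; rewrite /= addrA. Qed.
Let caddC : commutative cadd.
Proof. by move=> x y; apply: val_inj; rewrite /= addrC. Qed.
Let cadd0 : left_id (Corner zeroP) cadd.
Proof. by move=> x; apply: val_inj; rewrite /= add0r. Qed.
Let caddN : left_inverse (Corner zeroP) copp cadd.
Proof. by move=> x; apply: val_inj; rewrite /= addNr. Qed.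

HB.instance Definition _ :=
  GRing.isZmodule.Build corner caddA caddC cadd0 caddN.

Let cmulA : associative cmul.
Proof. by move=> x y z; apply: val_inj; rewrite /= mulrA. Qed.
Let cmul1 : left_id (Corner oneP) cmul.
Proof. by move=> x; apply: val_inj; rewrite /= corner_mull. Qed.
Let cmulr1 : right_id (Corner oneP) cmul.
Proof. by move=> x; apply: val_inj; rewrite /= corner_mulr. Qed.
Let cmulDl : left_distributive cmul +%R.
Proof. by move=> x y z; apply: val_inj; rewrite /= mulrDl. Qed.
Let cmulDr : right_distributive cmul +%R.
Proof. by move=> x y z; apply: val_inj; rewrite /= mulrDr. Qed.
Let cone_neq0 : Corner oneP != 0.
Proof. by rewrite -val_eqE /= proj_neq0. Qed.

HB.instance Definition _ := GRing.Zmodule_isNzRing.Build corner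
  cmulA cmul1 cmulr1 cmulDl cmulDr cone_neq0.

Let cscaleA a b x : cscale a (cscale b x) = cscale (a * b) x.
Proof. by apply: val_inj; rewrite /= scalerA. Qed.
Let cscale1 : left_id 1 cscale.
Proof. by move=> x; apply: val_inj; rewrite /= scale1r. Qed.
Let cscaleDr : right_distributive cscale +%R.
Proof. by move=> a x y; apply: val_inj; rewrite /= scalerDr. Qed.
Let cscaleDl x : {morph cscale^~ x : a b / a + b}.
Proof. by move=> a b; apply: val_inj; rewrite /= scalerDl. Qed.

HB.instance Definition _ := GRing.Zmodule_isLmodule.Build R[i] corner
  cscaleA cscale1 cscaleDr cscaleDl.

Let cscaleAl (a : R[i]) x y : a *: (x * y) = (a *: x) * y.
Proof. by apply: val_inj; rewrite /= scalerAl. Qed.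
HB.instance Definition _ := GRing.Lmodule_isLalgebra.Build R[i] corner cscaleAl.

Let cscaleAr (a : R[i]) x y : a *: (x * y) = x * (a *: y).
Proof. by apply: val_inj; rewrite /= scalerAr. Qed.
HB.instance Definition _ := GRing.Lalgebra_isAlgebra.Build R[i] corner cscaleAr.

Let cstar x := Corner (starP x).
Let ccnorm x := cnorm (val x).

Let cstarK : involutive cstar.
Proof. by move=> x; apply: val_inj; rewrite /= starK. Qed.
Let cstarD : {morph cstar : x y / x + y}.
Proof. by move=> x y; apply: val_inj; rewrite /= starD. Qed.
Let cstarZ (a : R[i]) x : cstar (a *: x) = a^* *: cstar x.
Proof. by apply: val_inj; rewrite /= starZ. Qed.
Let cstarM x y : cstar (x * y) = cstar y * cstar x.
Proof. by apply: val_inj; rewrite /= starM. Qed.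
Let ccnorm0 x : ccnorm x = 0 -> x = 0.
Proof. by move=> /cnorm0_eq0 x0; apply: val_inj. Qed.
Let ccnormD x y : ccnorm (x + y) <= ccnorm x + ccnorm y.
Proof. exact: cnormD. Qed.
Let ccnormZ (a : R[i]) x :
  ccnorm (a *: x) = ComplexField.Normc.normc a * ccnorm x.
Proof. exact: cnormZ. Qed.
Let ccnormM x y : ccnorm (x * y) <= ccnorm x * ccnorm y.
Proof. exact: cnormM. Qed.
Let ccstar_identity x : ccnorm (cstar x * x) = ccnorm x ^+ 2.
Proof. exact: cstar_identity. Qed.
Let ccomplete (u : nat -> corner) :
  (forall eps : R, 0 < eps -> exists n0 : nat, forall m n : nat,
     (n0 <= m)%N -> (n0 <= n)%N -> ccnorm (u m - u n) < eps) ->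
  exists l : corner, (ccnorm (u n - l) @[n --> \oo] --> (0 : R))%classic.
Proof.
move=> /(@cstar_complete R A (val \o u))[l ul].
have lP : q * (q * l * q) * q == q * l * q.
  by rewrite !mulrA proj_idem -!mulrA proj_idem.
(* The limit taken in [A] is compressed to the corner; compression by [q] does not increase the norm
   of [u n - l]. *)
exists (Corner lP); apply: (squeeze_cvgr _ _ ul); last exact: cvg_cst.
apply: nearW => n; rewrite cnorm_ge0/= /ccnorm /=.
have -> : val (u n) - q * l * q = q * (val (u n) - l) * q.
  by rewrite mulrBr mulrBl corner_mull corner_mulr.
have q1 : cnorm q <= 1.
  by apply: selfadjoint_idem_cnorm_le1; rewrite ?proj_star ?proj_idem.
have m1 (a b : R) : 0 <= a -> a <= 1 -> 0 <= b -> a * b <= b.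
  by move=> a0 a1 b0; rewrite ler_piMl.
rewrite (le_trans (cnormM _ _))// mulrC (le_trans (m1 _ _ _ _ _)) ?cnorm_ge0//.
by rewrite (le_trans (cnormM _ _))// m1 ?cnorm_ge0.
Qed.

HB.instance Definition _ := isCStarAlgebra.Build R corner cstarK cstarD cstarZ
  cstarM ccnorm0 ccnormD ccnormZ ccnormM ccstar_identity ccomplete.


End Corner.

(** * A Cuntz-Krieger family with nonzero vertex projections *)

Section Representation.
Variable R : realType.

(* With [q = 1 - x x^*] the corner [q A q] has trivial unit class in K_0, so,
   unlike [A] in general, it contains a unital copy of O_2. *)
Lemma exists_cuntz2 (A : cstarAlgType R) (x y : A) :
  star x * x = 1 -> star y * y = 1 -> star x * y = 0 ->
  exists (B : cstarAlgType R) (a b : B),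
    [/\ star a * a = 1, star b * b = 1 & a * star a + b * star b = 1].
Proof.
move=> xx yy xy; have yx : star y * x = 0 by rewrite -[x]starK -starM xy star0.
pose q := 1 - x * star x.
have qs : star q = q by rewrite starB star1 starM starK.
have qy : q * y = y by rewrite mulrBl mul1r -mulrA xy mulr0 subr0.
have yq : star y * q = star y by rewrite -{1}qs -starM qy.
have xq : star x * q = 0 by rewrite mulrBr mulr1 mulrA xx mul1r subrr.
have qq : q * q = q by rewrite {1}/q mulrBl mul1r -mulrA xq mulr0 subr0.
have qE : q + x * star x = 1 by rewrite subrK.
clearbody q; have q0 : q != 0.
  apply/eqP => q0; have := oner_neq0 A.
  by rewrite -yy -qy q0 mul0r mulr0 eqxx.
pose r := q - y * star y.
have rs : star r = r by rewrite starB starM starK qs.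
have ry : r * y = 0 by rewrite mulrBl qy -mulrA yy mulr1 subrr.
have yr : star y * r = 0 by rewrite -rs -starM ry star0.
have qr : q * r = r by rewrite mulrBr qq mulrA qy.
have rq : r * q = r by rewrite mulrBl qq -mulrA yq.
have rr : r * r = r by rewrite {1}/r mulrBl qr -mulrA yr mulr0 subr0.
have rE : r + y * star y = q by rewrite subrK.
clearbody r; pose Q := NonzeroProj qs qq q0.
(* The generators are [y * q] and [y * x * star y + r]. Their range projections add up to
   [y * (q + x * star x) * star y + r], which is [y * star y + r = q]. *)
have aP : q * (y * q) * q == y * q by rewrite mulrA qy -mulrA qq.
have [b bE] : exists b, b = y * x * star y + r by eexists.
have bP : q * b * q == b.
  by rewrite bE mulrDr mulrDl qr rq !mulrA qy -!mulrA yq.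
have bs : star b = y * star x * star y + r.
  by rewrite bE starD !starM starK rs mulrA.
exists (corner Q), (@Corner _ _ Q _ aP), (@Corner _ _ Q _ bP).
split; apply: val_inj => /=.
- by rewrite starM qs !mulrA -(mulrA q) yy mulr1 qq.
- rewrite bs bE mulrDl !mulrDr rr -(mulrA _ (star y) r) yr mulr0 addr0.
  rewrite !mulrA ry !mul0r add0r -(mulrA _ (star y) y) yy mulr1.
  by rewrite -(mulrA y (star x)) xx mulr1 addrC rE.
- rewrite bs bE starM qs mulrDl !mulrDr rr -(mulrA _ (star y) r) yr mulr0 addr0.
  rewrite !mulrA ry !mul0r add0r -(mulrA _ (star y) y) yy mulr1 -(mulrA y q q) qq.
  rewrite addrA -(mulrA y x) -mulrDl -mulrDr qE mulr1 addrC; exact: rE.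
Qed.

(** Induction on the size of [X]: a new index receives [a], and the previous isometries are moved
    under the range of [b] by left multiplication. *)
Lemma exists_cuntz_family (B : cstarAlgType R) (a b : B) :
  star a * a = 1 -> star b * b = 1 -> a * star a + b * star b = 1 ->
  forall (I : finType) (X : {set I}), X != finset.set0 ->
  exists U : I -> B,
    (forall i, star (U i) * U i = 1) /\ \sum_(i in X) U i * star (U i) = 1.
Proof.
move=> aa bb ab I X; have [n] := ubnP #|X|.
elim: n X => // n IH X; rewrite ltnS => Xn /finset.set0Pn[i iX].
have [X0|X0] := eqVneq (X :\ i)%SET finset.set0.
  exists (fun=> 1); split=> [j|]; first by rewrite star1 mulr1.
  by rewrite (big_setD1 i)//= X0 big_set0 addr0 star1 mulr1.
have [|U [UU sumU]] := IH _ _ X0.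
  by move: Xn; rewrite (cardsD1 i X) iX.
exists (fun j => if j == i then a else b * U j); split=> [j|].
  case: ifP => // _.
  by rewrite starM mulrA -(mulrA (star (U j))) bb mulr1 UU.
rewrite (big_setD1 i)//= eqxx.
rewrite (eq_bigr (fun j => b * (U j * star (U j)) * star b)); last first.
  move=> j; rewrite !inE => /andP[/negbTE-> _].
  by rewrite starM !mulrA.
by rewrite -mulr_suml -mulr_sumr sumU mulr1.
Qed.

(** One Cuntz family [W] is indexed by the vertices and, for each vertex [v], another [U v] by the
    edges leaving [v]. The partial isometry [T e] goes from the range of [W (t e)] into that of
    [W (s e)], and the ranges over a source [v] fill that of [W v]; hence the vertex projection is
    [W v * star (W v)], which is nonzero. *)
Lemma exists_cuntz_krieger_family (B : cstarAlgType R) (a b : B) :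
  star a * a = 1 -> star b * b = 1 -> a * star a + b * star b = 1 ->
  forall (N : nat) (E : finType) (s t : E -> 'I_N), (0 < N)%N ->
  (forall v, exists e, s e = v) ->
  exists T : E -> B, cuntz_krieger_family (edge_matrix s t) T /\
    forall v, vertex_proj s T v != 0.
Proof.
move=> aa bb ab N E s t N0 has_out.
have [W [WW sumW]] : exists W : 'I_N -> B,
    (forall v, star (W v) * W v = 1) /\ \sum_v W v * star (W v) = 1.
  have [|W [WW sumW]] :=
      exists_cuntz_family aa bb ab (X := finset.setT : {set 'I_N}).
    by apply/finset.set0Pn; exists (Ordinal N0); rewrite inE.
  by exists W; split=> //; rewrite -[RHS]sumW; apply: eq_bigl => v; rewrite inE.
have /boolp.choice[U UP] : forall v, exists U : E -> B,
    (forall e, star (U e) * U e = 1) /\ \sum_(e | s e == v) U e * star (U e) = 1.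
  move=> v; have [|U [UU sumU]] :=
      exists_cuntz_family aa bb ab (X := [set e | s e == v]%SET).
    by have [e ev] := has_out v; apply/finset.set0Pn; exists e; rewrite inE ev.
  by exists U; split=> //; rewrite -[RHS]sumU; apply: eq_bigl => e; rewrite inE.
pose T e := W (s e) * U (s e) e * star (W (t e)).
have TT e : T e * star (T e) =
    W (s e) * (U (s e) e * star (U (s e) e)) * star (W (s e)).
  by rewrite !starM starK !mulrA -(mulrA _ _ (W (t e))) WW mulr1.
have sT e : star (T e) * T e = W (t e) * star (W (t e)).
  rewrite !starM starK !mulrA -(mulrA _ _ (W (s e))) WW mulr1.
  by rewrite -(mulrA _ _ (U (s e) e)) (UP _).1 mulr1.
have PT v : vertex_proj s T v = W v * star (W v).
  rewrite /vertex_proj.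
  rewrite (eq_bigr (fun e => W v * (U v e * star (U v e)) * star (W v))).
    by rewrite -mulr_suml -mulr_sumr (UP _).2 mulr1.
  by move=> e /eqP <-; exact: TT.
exists T; split; last first.
  move=> v; rewrite PT; apply/eqP => P0; have := oner_neq0 B.
  by rewrite -(WW v) -[W v]mulr1 -{2}(WW v) (mulrA (W v)) P0 mul0r mulr0 eqxx.
split=> [e||e].
- by rewrite -mulrA sT /T -!mulrA (mulrA (star (W (t e)))) WW mul1r.
- rewrite -[RHS]sumW (partition_big s xpredT)//=; apply: eq_bigr => v _.
  exact: PT.
- by rewrite sT -PT /vertex_proj big_mkcond; apply: eq_bigr => f _;
    rewrite /edge_matrix eq_sym; case: ifP.
Qed.

End Representation.

Lemma exists_cuntz_krieger_nondegenerate (R : realType) (N : nat) (E : finType)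
    (s t : E -> 'I_N) (A : cstarAlgType R) (S : E -> A) :
  (forall v, exists e, s e = v) -> (2 <= #|E|)%N -> cuntz_family S ->
  exists (B : cstarAlgType R) (T : E -> B),
    cuntz_krieger_family (edge_matrix s t) T /\ forall v, vertex_proj s T v != 0.
Proof.
move=> has_out /card_gt1P[e [f [_ _ ef]]] [SS sumS].
have orth : star (S e) * S f = 0.
  by apply: partial_isometries_orth sumS _ _ ef => g; rewrite -mulrA SS mulr1.
have [B [a [b [aa bb ab]]]] := exists_cuntz2 (SS e) (SS f) orth.
exists B; apply: (exists_cuntz_krieger_family aa bb ab) => //.
by case: N s t has_out => [s|//]; case: (s e).
Qed.

(** The homomorphism given by universality maps each vertex projection to its counterpart in [B]. *)
Lemma cuntz_krieger_vertex_proj_neq0 (R : realType) (N : nat) (E : finType)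
    (s t : E -> 'I_N) (A B : cstarAlgType R) (S : E -> A) (T : E -> B) :
  is_cuntz_krieger_algebra (edge_matrix s t) S ->
  cuntz_krieger_family (edge_matrix s t) T ->
  forall v, vertex_proj s T v != 0 -> vertex_proj s S v != 0.
Proof.
move=> [_ univ] ckT v; have [phi [[[phiL _ phiM phis] phiS] _]] := univ B T ckT.
have phiD x y : phi (x + y) = phi x + phi y.
  by rewrite -[x]scale1r phiL !scale1r.
have phi0 : phi 0 = 0 by apply: (addrI (phi 0)); rewrite -phiD !addr0.
apply: contraNneq => Pv0; apply/eqP; rewrite -phi0 -Pv0 (big_morph _ phiD phi0).
by apply: eq_bigr => e _; rewrite phiM phis phiS.
Qed.

(** * Words *)

(* [st] is the stack of edges whose adjoint has been read and not yet cancelled,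
   innermost first; [ok st e] tells whether [S_e^*] may be read on top of it. *)
Fixpoint dyck (E : eqType) (ok : seq E -> E -> bool) (st : seq E)
    (X : seq (symbol E)) : bool :=
  match X, st with
  | [::], _ => nilp st
  | inr e :: X', _ => ok st e && dyck ok (e :: st) X'
  | inl e :: X', f :: st' => (e == f) && dyck ok st' X'
  | inl _ :: _, [::] => false
  end.

Lemma sub_dyck (E : eqType) (ok1 ok2 : seq E -> E -> bool) st X :
  (forall st e, ok1 st e -> ok2 st e) -> dyck ok1 st X -> dyck ok2 st X.
Proof.
move=> ok12; elim: X st => [//|[e|e] X IH] [|f st] //=.
- by case/andP=> -> /IH.
- by case/andP=> /ok12 -> /IH.
- by case/andP=> /ok12 -> /IH.
Qed.

(** * Words in the Cuntz algebra *)

Section CuntzWords.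
Variables (R : realType) (E : finType) (B : cstarAlgType R) (S : E -> B).

(** The innermost pushed edge is the rightmost factor, next to the unread part of the word. *)
Fixpoint stack_val (st : seq E) : B :=
  if st is e :: st' then stack_val st' * star (S e) else 1.

Lemma eval_word_cons x X :
  eval_word S (x :: X) = eval_symbol S x * eval_word S X.
Proof. by rewrite /eval_word big_cons. Qed.

Hypothesis cuntzS : cuntz_family S.
Hypothesis card_E : (2 <= #|E|)%N.

Let exists_other (e : E) : exists f, e != f.
Proof.
have : (0 < #|predC1 e|)%N by have := cardC1 e; lia.
by case/card_gt0P => f; rewrite inE => fe; exists f; rewrite eq_sym.
Qed.

Let neq0 e : S e != 0.
Proof.
apply/eqP => Se0; have := oner_neq0 B.
by rewrite -(cuntzS.1 e) Se0 mulr0 eqxx.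
Qed.

Let orth e f : e != f -> star (S e) * S f = 0.
Proof.
apply: partial_isometries_orth cuntzS.2 e f => e.
by rewrite -mulrA cuntzS.1 mulr1.
Qed.

(** Pushing moves a factor onto the stack, and popping uses that [star (S f) * S e] is 1 or 0. For
    the two ways of getting stuck, take [f != e]: a product ending in [star (S e)] kills [S f] on
    its right, and one starting with [S e] is killed by [star (S f)] on its left, so neither is
    1. *)
Lemma eval_word_cuntz_eq1_stack st X :
  (stack_val st * eval_word S X == 1) = dyck (fun _ _ => true) st X.
Proof.
elim: X st => [|[e|e] X IH] st; rewrite ?eval_word_cons.
- rewrite /eval_word big_nil mulr1; case: st => [|e st]/=; first exact: eqxx.
  apply/eqP => e1; have [f ef] := exists_other e.
  have := neq0 f; rewrite -[S f]mul1r -e1 -mulrA orth// mulr0.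
  by rewrite eqxx.
- case: st => [|f st] /=.
    apply/eqP; rewrite mul1r => e1; have [f ef] := exists_other e.
    have := neq0 f; rewrite -[S f]starK -[star (S f)]mulr1 -e1 mulrA.
    by rewrite orth 1?eq_sym// mul0r star0 eqxx.
  rewrite !mulrA -(mulrA (stack_val st)).
  have [->|ef] := eqVneq e f; first by rewrite cuntzS.1 mulr1 IH.
  have fe : f != e by rewrite eq_sym.
  by rewrite orth// mulr0 mul0r [0 == _]eq_sym oner_eq0.
- by rewrite mulrA -/(stack_val (e :: st)) IH; case: st.
Qed.

Lemma eval_word_cuntz_eq1 X :
  (eval_word S X == 1) = dyck (fun _ _ => true) [::] X.
Proof. by rewrite -eval_word_cuntz_eq1_stack mul1r. Qed.

End CuntzWords.

(** * Words in the Cuntz-Krieger algebra *)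

Section GraphWords.
Variables (R : realType) (N : nat) (E : finType) (s t : E -> 'I_N).
Variables (A : cstarAlgType R) (S : E -> A).
Hypothesis ckS : cuntz_krieger_family (edge_matrix s t) S.
Local Notation P := (vertex_proj s S).

(** An admissible stack, read from its top, is a directed path ending at [i]. This is its initial
    vertex, at which the next pushed edge has to end. *)
Definition path_end (i : 'I_N) (st : seq E) : 'I_N :=
  if st is e :: _ then s e else i.

Definition graph_ok (i : 'I_N) (st : seq E) (e : E) : bool :=
  t e == path_end i st.

Let orth e f : e != f -> star (S e) * S f = 0.
Proof. by case: ckS => SSS sum1 _; exact: partial_isometries_orth. Qed.

Let star_mul_self e : star (S e) * S e = P (t e).
Proof.
case: ckS => _ _ ->; rewrite /vertex_proj [RHS]big_mkcond /=.
by apply: eq_bigr => f _; rewrite /edge_matrix eq_sym; case: ifP.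
Qed.

Lemma vertex_proj_mul v e : P v * S e = S e *+ (v == s e).
Proof.
case: ckS => SSS _ _; rewrite mulr_suml; have [->|ve] := eqVneq v (s e).
  rewrite (bigD1 e)//= SSS big1 ?addr0// => f /andP[_ fe].
  by rewrite -mulrA orth// mulr0.
rewrite big1// => f /eqP fv; rewrite -mulrA orth ?mulr0//.
by apply: contraNneq ve => <-; rewrite fv.
Qed.

Lemma vertex_proj_orth v w : P v * P w = P v *+ (v == w).
Proof.
rewrite {2}/vertex_proj mulr_sumr.
under eq_bigr => f /eqP sf do rewrite mulrA vertex_proj_mul sf mulrnAl.
by rewrite sumrMnl; have [->|_] := eqVneq v w.
Qed.

Lemma star_vertex_proj v : star (P v) = P v.
Proof.
by rewrite /vertex_proj star_sum; apply: eq_bigr => e _; rewrite starM starK.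
Qed.

Lemma vertex_proj_mul_star v e : P v * star (S e) = star (S e) *+ (v == t e).
Proof.
case: ckS => SSS _ _; have eqP : star (S e) = P (t e) * star (S e).
  by rewrite -star_mul_self -{1}[S e]SSS !starM starK mulrA.
rewrite {1}eqP mulrA vertex_proj_orth mulrnAl.
by have [->|//] := eqVneq v (t e); rewrite -eqP.
Qed.

Lemma star_mul_vertex_proj e : star (S e) * P (s e) = star (S e).
Proof.
by rewrite -(star_vertex_proj (s e)) -starM vertex_proj_mul eqxx mulr1n.
Qed.

Lemma stack_val_path_end i st : 
  P i * stack_val S st * P (path_end i st) = P i * stack_val S st.
Proof.
case: st => [|e st] /=; first by rewrite mulr1 vertex_proj_orth eqxx.
by rewrite -!mulrA star_mul_vertex_proj.
Qed.

Fixpoint graph_stack (i : 'I_N) (st : seq E) : bool :=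
  if st is e :: st' then graph_ok i st' e && graph_stack i st' else true.

(** The stack absorbs the projection at its [path_end] on the right. A pop produces exactly this
    projection, and a push of an edge ending at another vertex is annihilated by it. *)
Lemma eval_word_graph_stack i st X :
  graph_stack i st -> dyck (fun _ _ => true) st X ->
  P i * stack_val S st * eval_word S X = P i *+ dyck (graph_ok i) st X.
Proof.
elim: X st => [|[e|e] X IH] st; rewrite ?eval_word_cons.
- by case: st => // _ _; rewrite /eval_word big_nil !mulr1.
- case: st => [//|f st] /= /andP[/eqP okf gst] /andP[/eqP-> dX].
  rewrite eqxx /= -IH// -(stack_val_path_end i st) -okf -star_mul_self.
  by rewrite !mulrA.
- move=> gst /= dX; rewrite mulrA; case: (boolP (graph_ok i st e)) => /= ok.
    by rewrite -(mulrA (P i)) -[_ * star _]/(stack_val S (e :: st)) IH//= ok.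
  rewrite -(stack_val_path_end i st) -(mulrA _ (P _)) vertex_proj_mul_star.
  by move: ok; rewrite /graph_ok eq_sym => /negbTE->; rewrite mulr0 mul0r.
Qed.

Lemma eval_word_graph i X : dyck (fun _ _ => true) [::] X ->
  P i * eval_word S X = P i *+ dyck (graph_ok i) [::] X.
Proof. by move=> dX; rewrite -eval_word_graph_stack// mulr1. Qed.

Hypothesis P_neq0 : forall v, P v != 0.

Lemma eval_word_eq_vertex_proj i x X : dyck (fun _ _ => true) [::] (x :: X) ->
  (eval_word S (x :: X) == P i) = dyck (graph_ok i) [::] (x :: X).
Proof.
case: x => // e; set Y := _ :: X => dY; have := eval_word_graph i dY.
case: (boolP (dyck _ _ Y)) => [|nY] PY; last first.
  apply/eqP => YP; move: PY; rewrite YP vertex_proj_orth eqxx => /eqP.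
  by rewrite (negbTE (P_neq0 i)).
case/andP: PY => /eqP /= te _; rewrite mulr1n => <-.
by rewrite /Y eval_word_cons /= mulrA vertex_proj_mul_star -te !eqxx.
Qed.

Lemma eval_word_neq0 x X : dyck (fun _ _ => true) [::] (x :: X) ->
  (eval_word S (x :: X) != 0) = [exists i, dyck (graph_ok i) [::] (x :: X)].
Proof.
case: x => // e dX; apply/idP/existsP => [eX|[j]]; last first.
  by rewrite -eval_word_eq_vertex_proj// => /eqP ->.
(* The only candidate vertex is where the first pushed edge ends, since its projection fixes the
   word. *)
exists (t e); rewrite -eval_word_eq_vertex_proj//.
have := eval_word_graph (t e) dX.
have -> : P (t e) * eval_word S (inr e :: X) = eval_word S (inr e :: X).
  by rewrite eval_word_cons mulrA vertex_proj_mul_star eqxx.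
by move=> XP; move: eX; rewrite XP; case: dyck; rewrite ?eqxx.
Qed.

Lemma dyck_graph_inj i j x X : dyck (graph_ok i) [::] (x :: X) ->
  dyck (graph_ok j) [::] (x :: X) -> i = j.
Proof.
by case: x => //= e /andP[/eqP ti _] /andP[/eqP tj _]; exact: etrans (esym ti) tj.
Qed.

End GraphWords.

(** * Counting *)

Section Counting.
Local Open Scope nat_scope.
Variables (N : nat) (E : finType) (s t : E -> 'I_N).

Fixpoint dyck_count (i : 'I_N) (st : seq E) (m : nat) : nat :=
  if m is m'.+1 then
    \sum_(e | graph_ok s t i st e) dyck_count i (e :: st) m' +
    (if st is _ :: st' then dyck_count i st' m' else 0)
  else nilp st.

Lemma sum_tupleS (T : finType) m (F : m.+1.-tuple T -> nat) :
  \sum_X F X = \sum_(x : T) \sum_(X : m.-tuple T) F (cons_tuple x X).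
Proof.
rewrite pair_big (reindex (fun p : T * m.-tuple T => cons_tuple p.1 p.2))//=.
exists (fun X => (thead X, behead_tuple X)) => [[x X] _|X _] /=.
  by congr (_, _); apply: val_inj.
by rewrite [in RHS](tuple_eta X); apply: val_inj.
Qed.

(** Both sides obey the same recursion on the first symbol; among the pops only the top edge of the
    stack contributes. *)
Lemma card_dyck i st m :
  #|[set X : m.-tuple (symbol E) | dyck (graph_ok s t i) st X]| =
  dyck_count i st m.
Proof.
rewrite -sum1_card big_mkcond; under eq_bigr do rewrite inE.
elim: m st => [|m IH] st.
  by rewrite (big_pred1 [tuple]) => [|X]; [case: st|by rewrite (tuple0 X) /= eqxx].
rewrite sum_tupleS big_sumType /= addnC; congr (_ + _).
  rewrite [RHS]big_mkcond; apply: eq_bigr => e _; case: ifP => ok.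
    by rewrite -IH.
  by rewrite big1.
case: st => [|f st]; first by rewrite big1// => e _; rewrite big1.
rewrite (bigD1 f)//= eqxx IH big1 ?addn0// => e /negbTE ef.
by rewrite ef big1.
Qed.

(** Every symbol changes the height of the stack by one, and the final height is 0. *)
Lemma dyck_count_odd i st m : odd (size st + m) -> dyck_count i st m = 0.
Proof.
elim: m st => [|m IH] st /=; first by case: st.
rewrite addnS /= => o; rewrite big1 => [|e _]; last by rewrite IH.
by case: st o => // e st; rewrite /= negbK => /IH.
Qed.

(* Splitting a word at the moment when the edge [e] is popped. *)
Lemma dyck_count_cat i st e st' m :
  dyck_count i (st ++ e :: st') m =
  \sum_(a < m) dyck_count (s e) st a * dyck_count i st' (m - a.+1).
Proof.
elim: m st => [|m IH] st; first by rewrite big_ord0; case: st.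
(* The index [a] counts the symbols read before [e] is popped. The term [a = 0] survives only for
   empty [st], when the first symbol pops [e]. *)
rewrite big_ord_recl subSS subn0 /=.
under [X in _ = _ + X]eq_bigr do rewrite add0n subSS mulnDl big_distrl/=.
rewrite big_split exchange_big/= addnCA; congr (_ + _).
  apply: eq_big => [g|g _]; first by case: st.
  by rewrite -cat_cons IH.
case: st => [|f st] /=; last by rewrite IH.
by rewrite mul1n big1 ?addn0// => a _; rewrite mul0n.
Qed.

Lemma sum_odd0 n (F : nat -> nat) : (forall a, odd a -> F a = 0) ->
  \sum_(a < (2 * n).+1) F a = \sum_(k < n.+1) F (2 * k).
Proof.
move=> F0; elim: n => [|n IH]; first by rewrite !big_ord1.
rewrite mulnS big_ord_recr/= big_ord_recr/= IH [in RHS]big_ord_recr/= -mulnS.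
by rewrite F0 ?addn0//= mul2n odd_double.
Qed.

Lemma dyck_count_rec i n :
  dyck_count i [::] (2 * n.+1) =
  \sum_(k < n.+1) dyck_count i [::] (2 * k) *
    \sum_(j < N) vertex_matrix s t j i * dyck_count j [::] (2 * (n - k)).
Proof.
have single e m := dyck_count_cat i [::] e [::] m; rewrite /= in single.
have countS m : dyck_count i [::] m.+1 =
    \sum_(e | graph_ok s t i [::] e) dyck_count i [:: e] m by rewrite /= addn0.
rewrite mulnS add2n countS; under eq_bigr do rewrite single.
(* The part enclosed by the first edge has even length; reversing the sum makes [2 * k] the length
   of the part after the pop. *)
under eq_bigr => e _.
  rewrite (@sum_odd0 n (fun a => dyck_count (s e) [::] a *
    dyck_count i [::] ((2 * n).+1 - a.+1))); last first.
    by move=> a oa; rewrite dyck_count_odd.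
  rewrite (reindex_inj rev_ord_inj) /=.
  over.
rewrite exchange_big /=; apply: eq_bigr => k _.
have kn : k <= n by rewrite -ltnS.
rewrite subSS (_ : (2 * n).+1 - (2 * (n - k)).+1 = 2 * k); last by lia.
(* Grouping the first edges, all ending at [i], by their source [j] produces the entries of the
   vertex matrix. *)
rewrite [RHS]mulnC big_distrl/= (partition_big s xpredT)//=.
apply: eq_bigr => j _.
rewrite (eq_bigr
    (fun=> dyck_count j [::] (2 * (n - k)) * dyck_count i [::] (2 * k))).
  rewrite sum_nat_const mulnA; congr (_ * _ * _); apply: eq_card => e.
  by rewrite !inE andbC.
by move=> e /andP[_ /eqP->].
Qed.

End Counting.

(** * Coefficients of formal power series *)

Section PowerSeries.
Variable K : comNzRingType.

Lemma fps_coef_sum (I : Type) (r : seq I) (Q : pred I) (F : I -> fps K) n :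
  fps_coef (\sum_(i <- r | Q i) F i) n = \sum_(i <- r | Q i) fps_coef (F i) n.
Proof. by elim/big_rec2: _ => // i y x _ <-. Qed.

Lemma fps_coefMn (f : fps K) m n : fps_coef (f *+ m) n = fps_coef f n *+ m.
Proof. by elim: m => // m IH; rewrite !mulrS -IH. Qed.

Lemma fps_coef1D (f : fps K) n :
  fps_coef (1 + f) n = (n == 0%N)%:R + fps_coef f n.
Proof. by []. Qed.

Lemma fps_coefM (f g : fps K) n :
  fps_coef (f * g) n = \sum_(k < n.+1) fps_coef f k * fps_coef g (n - k).
Proof. by []. Qed.

Lemma fps_coefXM0 (f : fps K) : fps_coef (fpsX K * f) 0 = 0.
Proof. by rewrite fps_coefM big_ord1 mul0r. Qed.

Lemma fps_coefXMS (f : fps K) n : fps_coef (fpsX K * f) n.+1 = fps_coef f n.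
Proof.
rewrite fps_coefM 2!big_ord_recl big1 ?mul0r ?add0r ?addr0 ?mul1r ?subSS ?subn0//.
by move=> k _; rewrite mul0r.
Qed.

End PowerSeries.

(** * The functional equations *)

Theorem proposition6p2
  (R : realType) (N : nat) (E : finType) (s t : E -> 'I_N)
  (has_in : forall v : 'I_N, exists e : E, t e = v)
  (has_out : forall v : 'I_N, exists e : E, s e = v)
  (card_E : (2 <= #|E|)%N)
  (OA : cstarAlgType R) (S : E -> OA)
  (OA_univ : is_cuntz_krieger_algebra (edge_matrix s t) S)
  (OE : cstarAlgType R) (Shat : E -> OE)
  (OE_univ : is_cuntz_algebra Shat) :
  let fG : fps int := gen_series (catalan_number N S Shat) in
  let fGi (i : 'I_N) : fps int := gen_series (catalan_number_at s S Shat i) in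
  fG = \sum_(i < N) fGi i /\
  forall i : 'I_N,
    fGi i = 1 + fpsX _ * fGi i * \sum_(j < N) fGi j *+ vertex_matrix s t j i.
Proof.
have ckS : cuntz_krieger_family (edge_matrix s t) S := OA_univ.1.
have cuntzS : cuntz_family Shat := OE_univ.1.
have [B [T [ckT T0]]] :=
  exists_cuntz_krieger_nondegenerate t has_out card_E cuntzS.
have P0 v := cuntz_krieger_vertex_proj_neq0 OA_univ ckT (T0 v).
have graph_cuntz i X : dyck (graph_ok s t i) [::] X ->
    dyck (fun _ _ => true) [::] X.
  exact: sub_dyck.
have words n : catalan_words S Shat n.+1 =
    [set X | [exists i, dyck (graph_ok s t i) [::] (tval X)]].
  apply/setP => X; rewrite !inE (eval_word_cuntz_eq1 cuntzS card_E).
  case: (tval X) (size_tuple X) => // x Y _.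
  case: (boolP (dyck (fun _ _ => true) _ _)) => dX; rewrite ?andbT ?andbF.
    by rewrite (eval_word_neq0 ckS P0 dX).
  by apply/esym/negbTE; apply: contra dX => /existsP[j] /graph_cuntz.
have wordsi i n : [set X in catalan_words S Shat n.+1 |
      eval_word S X == vertex_proj s S i] =
    [set X | dyck (graph_ok s t i) [::] (tval X)].
  apply/setP => X; rewrite words !inE.
  case: (tval X) (size_tuple X) => // x Y _; apply/andP/idP => [[]|dX].
    case/existsP => j /graph_cuntz dX.
    by rewrite (eval_word_eq_vertex_proj ckS P0 i dX).
  split; first by apply/existsP; exists i.
  by rewrite (eval_word_eq_vertex_proj ckS P0 i (graph_cuntz _ _ dX)).
(* For [n = 0] the convention that the value is 1 agrees with the count of the empty word. *)
have countE i n : catalan_number_at s S Shat i n = dyck_count s t i [::] (2 * n).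
  by case: n => [|n]; rewrite // -card_dyck -wordsi.
have series_coefE i n : fps_coef (gen_series (catalan_number_at s S Shat i)) n =
    dyck_count s t i [::] (2 * n) :> int by rewrite -countE.
split=> [|i]; apply: fpsP => n.
  rewrite fps_coef_sum /= -(big_morph Posz PoszD (erefl 0)); congr Posz.
  case: n => [|n] /=; first by rewrite sum1_card card_ord.
  have cardE (Q : pred ((2 * n.+1).-tuple (symbol E))) :
      #|[set X | Q X]| = (\sum_X Q X)%N.
    rewrite -sum1_card big_mkcond; apply: eq_bigr => X _.
    by rewrite inE; case: (Q X).
  under eq_bigr do rewrite wordsi cardE.
  (* Summing indicators word by word: a word is admissible for at most one vertex, the one where its
     first pushed edge ends. *)
  rewrite words cardE exchange_big; apply: eq_bigr => X _ /=.
  case: (tval X) (size_tuple X) => // x Y _.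
  case: existsP => [[j dj]|nd]; last first.
    rewrite big1// => j _; case: (boolP (dyck _ _ _)) => // dj.
    by case: nd; exists j.
  rewrite (bigD1 j)// dj big1// => k kj.
  case: (boolP (dyck _ _ _)) => // /dyck_graph_inj/(_ dj) kj'.
  by rewrite kj' eqxx in kj.
(* The constant term is 1; the factor x shifts the product, so the coefficient at [n.+1] is the
   convolution of [dyck_count_rec]. *)
rewrite -mulrA fps_coef1D; case: n => [|n]; first by rewrite fps_coefXM0.
rewrite add0r fps_coefXMS fps_coefM series_coefE dyck_count_rec.
rewrite (big_morph Posz PoszD (erefl 0)); apply: eq_bigr => k _.
rewrite fps_coef_sum series_coefE PoszM; congr (_ * _).
rewrite (big_morph Posz PoszD (erefl 0)); apply: eq_bigr => j _.
by rewrite fps_coefMn series_coefE mulnC -mulr_natr PoszM natz.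
Qed.
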